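(* Let $n = p_1^{\alpha_1}\cdots p_r^{\alpha_r}$ be the prime factorisation of a positive integer $n$ (distinct primes, $\alpha_i>0$). Then \[\det(A_n) = \prod_{\substack{d_1, d_2 \mid n\\ 1 \le d_1 < d_2 \le n}} \mathcal{R}(\Phi_{d_2}, \Phi_{d_1}) = (-1)^{n-1}\prod_{i=1}^r p_i^{\frac{n(1-p_i^{-\alpha_i})}{p_i-1}}.\]
   Context: $\Phi_d$ is the $d$th cyclotomic polynomial. $\Psi_n : \mathbf{Z}[X]/(X^n-1) \to \bigoplus_{d \mid n} \mathbf{Z}[X]/(\Phi_d(X))$ is the natural map $f\bmod(X^n-1)\mapsto\bigoplus_{d\mid n}f\bmod\Phi_d(X)$, and $A_n$ is its matrix with respect to the basis $(1,\overline{X},\dots,\overline{X}^{n-1})$ of the domain and the bases $(1,\overline{X},\dots,\overline{X}^{\phi(d)-1})$ of the summands, with summands ordered by increasing $d$ (the $j$th column of $A_n$ is the coordinate vector of $\Psi_n(\overline{X}^j)$). For monic polynomials $f,g$, the resultant is $\mathcal{R}(f,g) = \prod_{\alpha}\prod_{\beta}(\alpha-\beta)$, the product over the roots $\alpha$ of $f$ and $\beta$ of $g$ (with multiplicity) in an algebraic closure. *)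

(* Defs.v *)
From HB Require Import structures.
From mathcomp Require Import all_boot all_order all_algebra all_field.
Set Implicit Arguments. Unset Strict Implicit. Unset Printing Implicit Defensive.
Import Order.TTheory GRing.Theory Num.Theory.
Local Open Scope ring_scope.

Definition rootsC (f : {poly int}) : seq algC :=
  sval (closed_field_poly_normal (map_poly (fun z : int => z%:~R : algC) f)).

(* Resultant of monic f, g: product over roots alpha of f and beta of g of (alpha - beta). *)
Definition resC (f g : {poly int}) : algC :=
  \prod_(a <- rootsC f) \prod_(b <- rootsC g) (a - b).

Definition row_labels (n : nat) : seq (nat * nat) :=
  flatten [seq [seq (d, k) | k <- iota 0 (totient d)] | d <- divisors n].

(* The matrix A_n of Psi_n: column j is the coordinate vector of
   (X^j mod Phi_d)_{d | n} in the bases (1, X, ..., X^{phi(d)-1}). *)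
Definition A_mat (n : nat) : 'M[int]_n :=
  \matrix_(i < n, j < n)
    let dk := nth (0%N, 0%N) (row_labels n) i in
    (('X ^+ j %% 'Phi_(dk.1)) : {poly int})`_(dk.2).

(* Main.v *)
Require Import Defs.
From HB Require Import structures.
From mathcomp Require Import all_boot all_order all_algebra all_field.
Set Implicit Arguments. Unset Strict Implicit. Unset Printing Implicit Defensive.
Import Order.TTheory GRing.Theory Num.Theory.
Local Open Scope ring_scope.
Import Pdiv.CommonRing Pdiv.RingMonic.

(** The determinant. For monic f_1, ..., f_r of total degree n, replace the
    monomial basis of the polynomials of degree < n by 1, ..., X^(m-1), F, X F, ...,
    where F = f_1 ... f_(r-1) has degree m. This unitriangular change of basis makes
    the matrix of P |-> (P mod f_i)_i block triangular; the last diagonal block is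
    multiplication by F modulo f_r, whose determinant is R(f_r, F) because
    multiplication by X - b modulo f_r is C - b, with C the companion matrix of f_r.
    By induction the determinant is the product of the R(f_j, f_i) over i < j.

    The absolute value. Write n = p^a m with p not dividing m. The Phi_(qd), for
    q | p^a, multiply to Phi_d(X^(p^a)), and substituting X^k in both arguments raises
    a resultant to the k-th power; so the pairs over distinct d | m contribute the
    (p^a)-th power of the product for m. The pairs over a single d contribute powers
    of |R(Phi_(pd), Phi_d)| = p^phi(d), which is obtained by differentiating
    Phi_d Phi_(pd) = Phi_d(X^p) at the roots of Phi_d.

    The sign. For d > 2 the roots of Phi_d come in pairs of conjugate non-real
    numbers, so R(Phi_d, g) >= 0 for every g; only R(Phi_2, Phi_1) is negative. *)

(** * Products over pairs of positions in a sequence *)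

Section ProdPairs.

Variables (T : Type) (R : comPzSemiRingType).
Implicit Types (F : T -> T -> R) (s t : seq T) (x : T).

Fixpoint prod_pairs F s : R :=
  if s is x :: s' then \prod_(y <- s') F x y * prod_pairs F s' else 1.

Lemma prod_pairs_cat F s t :
  prod_pairs F (s ++ t) =
  prod_pairs F s * prod_pairs F t * \prod_(x <- s) \prod_(y <- t) F x y.
Proof.
elim: s => [|x s IHs] /=; first by rewrite big_nil mul1r mulr1.
by rewrite big_cons big_cat IHs /= [LHS](AC (2*(2*1)) ((1*3)*4*(2*5))).
Qed.

Lemma prod_pairs_rcons F s x :
  prod_pairs F (rcons s x) = prod_pairs F s * \prod_(y <- s) F y x.
Proof.
rewrite -cats1 prod_pairs_cat /= big_nil !mulr1.
by under eq_bigr do rewrite big_seq1.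
Qed.

Lemma prod_pairsX F s k :
  prod_pairs (fun x y => F x y ^+ k) s = prod_pairs F s ^+ k.
Proof. by elim: s => [|x s IHs] /=; rewrite ?expr1n // exprMn IHs prodrXl. Qed.

End ProdPairs.

Lemma prod_pairs_map (T U : Type) (R : comPzSemiRingType) (h : U -> T)
    (F : T -> T -> R) s :
  prod_pairs F (map h s) = prod_pairs (fun x y => F (h x) (h y)) s.
Proof. by elim: s => //= x s ->; rewrite big_map. Qed.

Lemma prod_pairs_flatten (T : Type) (R : comPzSemiRingType)
    (F : T -> T -> R) (ss : seq (seq T)) :
  prod_pairs F (flatten ss) =
  \prod_(s <- ss) prod_pairs F s *
  prod_pairs (fun s t => \prod_(x <- s) \prod_(y <- t) F x y) ss.
Proof.
elim: ss => [|s ss IHss] /=; first by rewrite big_nil mulr1.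
rewrite prod_pairs_cat IHss big_cons.
under [X in _ * X = _]eq_bigr do rewrite big_flatten.
by rewrite exchange_big /= -!mulrA; do 2!congr (_ * _); rewrite mulrC.
Qed.

Lemma rmorph_prod_pairs (T : Type) (R S : comPzSemiRingType)
    (f : {rmorphism R -> S}) (F : T -> T -> R) s :
  f (prod_pairs F s) = prod_pairs (fun x y => f (F x y)) s.
Proof.
by elim: s => [|x s IHs] /=; rewrite ?rmorph1 // rmorphM rmorph_prod IHs.
Qed.

Section ProdPairsEqType.

Variables (T : eqType) (R : comPzSemiRingType).
Implicit Types (F G : T -> T -> R) (s t : seq T).

Lemma eq_in_prod_pairs F G s :
  {in s &, F =2 G} -> prod_pairs F s = prod_pairs G s.
Proof.
elim: s => //= x s IHs FG; rewrite IHs => [|y z ys zs]; last first.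
  by rewrite FG ?inE ?ys ?zs ?orbT.
by congr (_ * _); apply: eq_big_seq => y ys; rewrite FG ?inE ?eqxx ?ys ?orbT.
Qed.

Lemma perm_prod_pairs F s t :
  (forall x y, F x y = F y x) -> perm_eq s t -> prod_pairs F s = prod_pairs F t.
Proof.
move=> F_sym; elim: s t => [|x s IHs] t.
  by move/perm_size => /esym/size0nil->.
move=> st; have /splitPr tE : x \in t by rewrite -(perm_mem st) mem_head.
case: tE st => t1 t2; rewrite perm_sym perm_catC cat_cons perm_cons perm_catC.
rewrite perm_sym => st /=.
rewrite (IHs _ st) (perm_big _ st) big_cat !prod_pairs_cat /=.
under [X in _ = _ * X]eq_bigr do rewrite big_cons F_sym.
by rewrite big_split /= [LHS](AC (2*(2*1)) (3*(2*4)*(1*5))).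
Qed.

Lemma prod_pairs_sorted F s (r : rel T) :
    transitive r -> irreflexive r -> sorted r s ->
  prod_pairs F s = \prod_(x <- s) \prod_(y <- s | r x y) F x y.
Proof.
move=> r_trans r_irr; elim: s => [|x s IHs] /=; first by rewrite big_nil.
rewrite path_sortedE // => /andP[/allP rx /IHs->].
rewrite big_cons big_cons r_irr; congr (_ * _).
  by rewrite [RHS]big_mkcond; apply: eq_big_seq => y /rx->.
apply: eq_big_seq => y /rx rxy; rewrite big_cons ifN //.
by apply/negP => /(r_trans _ _ _ rxy); rewrite r_irr.
Qed.

End ProdPairsEqType.

(** * The determinant of the Chinese remainder map *)

Lemma det_monic_coef (R : comNzRingType) n (b : 'I_n -> {poly R}) :
    (forall j, b j \is monic) -> (forall j, size (b j) = j.+1) ->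
  \det (\matrix_(i < n, j < n) (b j)`_i) = 1.
Proof.
move=> b_monic size_b; rewrite -det_tr det_trig; last first.
  by apply/is_trig_mxP => j i ji; rewrite !mxE nth_default // size_b.
by apply: big1 => j _; rewrite !mxE -(monicP (b_monic j)) lead_coefE size_b.
Qed.

Lemma size_prod_monic (R : nzRingType) (fs : seq {poly R}) :
    {in fs, forall f, f \is monic} ->
  size (\prod_(f <- fs) f) = (\sum_(f <- fs) (size f).-1)%N.+1.
Proof.
elim: fs => [|f fs IHfs]; first by rewrite !big_nil size_poly1.
case/forall_cons => f1 fs1; rewrite !big_cons size_monicM //; last first.
  by rewrite -size_poly_gt0 IHfs.
by rewrite IHfs // addnS [in LHS](polySpred (monic_neq0 f1)).
Qed.

Section ChineseRemainderMatrix.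

Variable R : comNzRingType.
Implicit Types (f g h p : {poly R}) (fs : seq {poly R}) (n : nat).

Lemma coef_rmodpM n g p h k : g \is monic -> (size p <= n)%N ->
  (rmodp (p * h) g)`_k = \sum_(j < n) p`_j * (rmodp ('X^j * h) g)`_k.
Proof.
move=> g1 p_le; rewrite -[p in LHS](take_poly_id p_le) /take_poly poly_def.
rewrite mulr_suml rmodp_sum // coef_sum; apply: eq_bigr => j _.
by rewrite -scalerAl rmodpZ // coefZ.
Qed.

Definition mulmodp_mx n g h : 'M[R]_n :=
  \matrix_(i, j) (rmodp ('X^i * h) g)`_j.

Lemma mulmodp_mx1 n g : size g = n.+1 -> mulmodp_mx n g 1 = 1%:M.
Proof.
move=> size_g; apply/matrixP => i j; rewrite !mxE mulr1 rmodp_small.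
  by rewrite coefXn eq_sym.
by rewrite size_polyXn size_g ltnS.
Qed.

Lemma mulmodp_mxM n g h1 h2 : g \is monic -> size g = n.+1 ->
  mulmodp_mx n g (h1 * h2) = mulmodp_mx n g h1 *m mulmodp_mx n g h2.
Proof.
move=> g1 size_g; apply/matrixP => i j; rewrite !mxE mulrA -rmodp_mulml //.
rewrite (@coef_rmodpM n) //; first by apply: eq_bigr => k _; rewrite !mxE.
by rewrite -ltnS -size_g ltn_rmodpN0 ?monic_neq0.
Qed.

Lemma det_mulmodp_prod n g (I : Type) (r : seq I) (F : I -> {poly R}) :
    g \is monic -> size g = n.+1 ->
  \det (mulmodp_mx n g (\prod_(i <- r) F i)) =
  \prod_(i <- r) \det (mulmodp_mx n g (F i)).
Proof.
move=> g1 size_g; apply: (big_morph (fun h => \det (mulmodp_mx n g h))).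
  by move=> h1 h2; rewrite mulmodp_mxM // det_mulmx.
by rewrite mulmodp_mx1 // det1.
Qed.

Lemma rmodp_Xn_monic g : g \is monic ->
  rmodp 'X^((size g).-1) g = 'X^((size g).-1) - g.
Proof.
move=> g1; have size_g := polySpred (monic_neq0 g1).
rewrite -{1}(subrK g 'X^_) addrC -[X in X + _]mul1r rmodp_addl_mul_small //.
rewrite [X in (_ < X)%N]size_g ltnS; apply/leq_sizeP => j.
rewrite leq_eqVlt => /predU1P[<- | j_gt]; rewrite coefB coefXn.
  by rewrite eqxx -lead_coefE (monicP g1) subrr.
by rewrite gtn_eqF // nth_default ?subrr // size_g.
Qed.

Lemma mulmodp_mx_XsubC g b : g \is monic ->
  mulmodp_mx (size g).-1 g ('X - b%:P) = companionmx g - b%:M.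
Proof.
move=> g1; apply/matrixP => i j; rewrite !mxE mulrBr -exprSr rmodpB // coefB.
have i_lt := ltn_ord i; congr (_ - _); last first.
  rewrite mulrC mul_polyC rmodpZ // coefZ rmodp_small ?size_polyXn -?ltn_predRL //.
  by rewrite coefXn eq_sym mulr_natr.
have [iE | iN] := eqVneq (i : nat) (size g).-1.-1.
  rewrite {1}iE (ltn_predK i_lt) rmodp_Xn_monic // coefB coefXn.
  by rewrite ltn_eqF ?sub0r.
rewrite rmodp_small ?coefXn 1?eq_sym // size_polyXn -!ltn_predRL ltn_neqAle iN.
by rewrite -ltnS (ltn_predK i_lt).
Qed.

Lemma horner_char_poly n (M : 'M[R]_n) b : (char_poly M).[b] = \det (b%:M - M).
Proof.
rewrite /char_poly -[LHS]/(horner_eval b _) -det_map_mx; congr (\det _).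
apply/matrixP => i j; rewrite !mxE /= /horner_eval !hornerE.
by case: eqP => _; rewrite ?mulr1n ?mulr0n !hornerE.
Qed.

Lemma det_mulmodp_XsubC n g b : g \is monic -> size g = n.+1 ->
  \det (mulmodp_mx n g ('X - b%:P)) = (-1) ^+ n * g.[b].
Proof.
move=> g1 /(congr1 predn)/= <-; rewrite mulmodp_mx_XsubC //.
by rewrite -[X in X.[b]](companionmxK g1) horner_char_poly -detZ scaleN1r opprB.
Qed.

Lemma det_mulmodp_prod_XsubC (r s : seq R) :
  \det (mulmodp_mx (size r) (\prod_(a <- r) ('X - a%:P))
                            (\prod_(b <- s) ('X - b%:P))) =
  \prod_(a <- r) \prod_(b <- s) (a - b).
Proof.
rewrite det_mulmodp_prod ?monic_prod_XsubC ?size_prod_XsubC //.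
rewrite exchange_big; apply: eq_bigr => b _ /=.
rewrite det_mulmodp_XsubC ?monic_prod_XsubC ?size_prod_XsubC // horner_prod.
rewrite -(count_predT r) -iter_mulr_1 -big_const_seq -big_split.
by apply: eq_bigr => a _ /=; rewrite hornerXsubC mulN1r opprB.
Qed.

Definition chinese_coords fs p : seq R :=
  flatten [seq mkseq (fun k => (rmodp p f)`_k) (size f).-1 | f <- fs].

Definition chinese_mx n fs : 'M[R]_n :=
  \matrix_(i, j) (chinese_coords fs 'X^j)`_i.

Lemma size_chinese_coords fs p :
  size (chinese_coords fs p) = (\sum_(f <- fs) (size f).-1)%N.
Proof.
by elim: fs => [|f fs IHfs]; rewrite ?big_nil // big_cons size_cat size_mkseq -IHfs.
Qed.

Lemma chinese_coords_rcons fs g p :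
  chinese_coords (rcons fs g) p =
  chinese_coords fs p ++ mkseq (fun k => (rmodp p g)`_k) (size g).-1.
Proof. by rewrite /chinese_coords map_rcons flatten_rcons. Qed.

Lemma nth_chinese_coords_eq0 fs p i :
  {in fs, forall f, rmodp p f = 0} -> (chinese_coords fs p)`_i = 0.
Proof.
elim: fs i => [|f fs IHfs] i; first by rewrite nth_nil.
case/forall_cons => pf /IHfs{}IHfs; rewrite nth_cat size_mkseq.
by case: ltnP => i_lt; rewrite ?IHfs // nth_mkseq // pf coef0.
Qed.

Lemma nth_chinese_coords n fs p i :
    {in fs, forall f, f \is monic} -> (size p <= n)%N ->
  (chinese_coords fs p)`_i = \sum_(j < n) p`_j * (chinese_coords fs 'X^j)`_i.
Proof.
move=> + p_le; elim: fs i => [|f fs IHfs] i.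
  by rewrite [LHS]nth_nil big1 // => j _; rewrite [X in _ * X]nth_nil mulr0.
case/forall_cons => f1 /IHfs{}IHfs; rewrite nth_cat size_mkseq.
under eq_bigr do rewrite nth_cat size_mkseq.
case: ltnP => i_lt; rewrite ?IHfs // nth_mkseq // -[p in LHS]mulr1.
rewrite (coef_rmodpM _ _ f1 p_le); apply: eq_bigr => j _.
by rewrite nth_mkseq // mulr1.
Qed.

Lemma det_chinese_mx_basis n fs (b : nat -> {poly R}) :
    {in fs, forall f, f \is monic} ->
    (forall j, b j \is monic) -> (forall j, size (b j) = j.+1) ->
  \det (chinese_mx n fs) =
  \det (\matrix_(i < n, j < n) (chinese_coords fs (b j))`_i).
Proof.
move=> fs1 b1 size_b.
rewrite -[LHS]mulr1 -(@det_monic_coef _ n b) // -det_mulmx; congr (\det _).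
apply/matrixP => i j; rewrite !mxE (@nth_chinese_coords n) ?size_b //.
by apply: eq_bigr => k _; rewrite !mxE mulrC.
Qed.

Lemma det_chinese_mx_rcons m d fs g :
    {in rcons fs g, forall f, f \is monic} ->
    m = (\sum_(f <- fs) (size f).-1)%N -> size g = d.+1 ->
  \det (chinese_mx (m + d) (rcons fs g)) =
  \det (chinese_mx m fs) * \det (mulmodp_mx d g (\prod_(f <- fs) f)).
Proof.
move=> monic_fsg mE size_g; set F := \prod_(f <- fs) f.
have /forall_cons[_ fs1] : {in g :: fs, forall f, f \is monic}.
  by move=> f; rewrite -mem_rcons; exact: monic_fsg.
have F1 : F \is monic by rewrite /F big_seq; apply: monic_prod => f /fs1.
have size_F : size F = m.+1 by rewrite size_prod_monic // mE.
pose b j := if (j < m)%N then 'X^j else 'X^(j - m) * F.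
rewrite (@det_chinese_mx_basis _ _ b) // => [|j|j]; first last.
- rewrite /b; case: ltnP => [_ | mj]; first exact: size_polyXn.
  rewrite size_Mmonic ?size_polyXn ?monic_neq0 ?monicXn // size_F.
  by rewrite addnS /= addSn subnK.
- by rewrite /b; case: ltnP => _; rewrite ?monicMl ?monicXn.
have coordsE j i : (chinese_coords (rcons fs g) (b j))`_i =
    if (i < m)%N then (chinese_coords fs (b j))`_i
    else (mkseq (fun k => (rmodp (b j) g)`_k) d)`_(i - m).
  by rewrite chinese_coords_rcons nth_cat size_chinese_coords -mE size_g.
rewrite -[X in \det X]submxK.
rewrite [ursubmx _](_ : _ = 0); last first.
  apply/matrixP => i j; rewrite !mxE coordsE /= ltn_ord.
  apply: nth_chinese_coords_eq0 => f f_fs /=.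
  rewrite /b /= ltnNge leq_addr /= /F (big_rem f) //= mulrCA mulrC.
  by rewrite rmodp_mull ?fs1.
rewrite det_lblock -[\det (mulmodp_mx _ _ _)]det_tr; congr (_ * _); congr (\det _).
  by apply/matrixP => i j; rewrite !mxE coordsE /b /= !ltn_ord.
apply/matrixP => i j; rewrite !mxE coordsE /b /= !ltnNge !leq_addr /= !addKn.
by rewrite nth_mkseq.
Qed.

Lemma det_chinese_mx n fs :
    {in fs, forall f, f \is monic} -> n = (\sum_(f <- fs) (size f).-1)%N ->
  \det (chinese_mx n fs) =
  prod_pairs (fun f g => \det (mulmodp_mx (size g).-1 g f)) fs.
Proof.
elim/last_ind: fs n => [|fs g IHfs] n monic_fsg nE.
  by rewrite big_nil in nE; rewrite nE det_mx00.
have /forall_cons[g1 fs1] : {in g :: fs, forall f, f \is monic}.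
  by move=> f; rewrite -mem_rcons; exact: monic_fsg.
have size_g := polySpred (monic_neq0 g1).
rewrite -cats1 big_cat big_seq1 in nE; rewrite nE det_chinese_mx_rcons //.
by rewrite IHfs // prod_pairs_rcons det_mulmodp_prod.
Qed.

End ChineseRemainderMatrix.

(** * Resultants of monic integer polynomials *)

Lemma map_rmodp (R S : nzRingType) (f : {rmorphism R -> S}) (p g : {poly R}) :
  g \is monic -> map_poly f (rmodp p g) = rmodp (map_poly f p) (map_poly f g).
Proof.
move=> g1; rewrite [in RHS](rdivp_eq g1 p) rmorphD rmorphM.
rewrite rmodp_addl_mul_small ?monic_map // [X in (_ < X)%N]size_map_poly_id0.
  by apply: leq_ltn_trans (size_poly _ _) _; rewrite ltn_rmodpN0 ?monic_neq0.
by rewrite (monicP g1) rmorph1 oner_eq0.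
Qed.

Lemma map_mulmodp_mx (R S : comNzRingType) (f : {rmorphism R -> S}) n
    (g h : {poly R}) : g \is monic ->
  map_mx f (mulmodp_mx n g h) = mulmodp_mx n (map_poly f g) (map_poly f h).
Proof.
move=> g1; apply/matrixP => i j.
by rewrite !mxE -coef_map map_rmodp // rmorphM /= map_polyXn.
Qed.

Local Notation pZtoC := (map_poly (intr : int -> algC)).

Lemma pZtoC_rootsC f :
  f \is monic -> pZtoC f = \prod_(z <- rootsC f) ('X - z%:P).
Proof.
move=> f1; rewrite /rootsC; case: closed_field_poly_normal => s /= {1}->.
by rewrite (monicP (monic_map _ f1)) scale1r.
Qed.

Lemma perm_rootsC f s :
  f \is monic -> pZtoC f = \prod_(z <- s) ('X - z%:P) -> perm_eq (rootsC f) s.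
Proof. by move=> f1; rewrite pZtoC_rootsC // => /prod_XsubC_eq. Qed.

Lemma mem_rootsC f z : f \is monic -> (z \in rootsC f) = root (pZtoC f) z.
Proof. by move=> f1; rewrite pZtoC_rootsC // root_prod_XsubC. Qed.

Lemma size_rootsC f : f \is monic -> size (rootsC f) = (size f).-1.
Proof.
move=> f1; have size_f : size (pZtoC f) = size f.
  by rewrite size_map_inj_poly //; exact: intr_inj.
by rewrite -size_f pZtoC_rootsC // size_prod_XsubC.
Qed.

Lemma resC_horner f g :
  g \is monic -> resC f g = \prod_(a <- rootsC f) (pZtoC g).[a].
Proof.
move=> g1; apply: eq_bigr => a _; rewrite pZtoC_rootsC // horner_prod.
by apply: eq_bigr => b _; rewrite hornerXsubC.
Qed.

Lemma det_mulmodp_resC f g : f \is monic -> g \is monic ->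
  (\det (mulmodp_mx (size g).-1 g f))%:~R = resC g f.
Proof.
move=> f1 g1; rewrite -(det_map_mx intr) map_mulmodp_mx //.
by rewrite !pZtoC_rootsC // -size_rootsC // det_mulmodp_prod_XsubC.
Qed.

Lemma rootsC1 : rootsC 1 = [::].
Proof. by apply/nilP; rewrite /nilp size_rootsC ?monic1 // size_poly1. Qed.

Lemma rootsCM f g : f \is monic -> g \is monic ->
  perm_eq (rootsC (f * g)) (rootsC f ++ rootsC g).
Proof.
move=> f1 g1; apply: perm_rootsC; first by rewrite monicMl.
by rewrite big_cat -!pZtoC_rootsC // rmorphM.
Qed.

Lemma resC_prodl (I : Type) (r : seq I) (F : I -> {poly int}) g :
    (forall i, F i \is monic) ->
  resC (\prod_(i <- r) F i) g = \prod_(i <- r) resC (F i) g.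
Proof.
move=> F1; elim: r => [|i r IHr]; first by rewrite !big_nil /resC rootsC1 big_nil.
rewrite !big_cons -IHr /resC (perm_big _ (rootsCM _ _)) ?monic_prod //.
by rewrite big_cat.
Qed.

Lemma resC_prodr (I : Type) (r : seq I) (F : I -> {poly int}) f :
    (forall i, F i \is monic) ->
  resC f (\prod_(i <- r) F i) = \prod_(i <- r) resC f (F i).
Proof.
move=> F1; rewrite resC_horner ?monic_prod //.
under [RHS]eq_bigr do rewrite resC_horner //.
rewrite exchange_big; apply: eq_bigr => a _ /=.
by rewrite rmorph_prod horner_prod.
Qed.

Lemma norm_resC_sym f g : `|resC f g| = `|resC g f|.
Proof.
rewrite /resC exchange_big /= !normr_prod; apply: eq_bigr => a _.
by rewrite !normr_prod; apply: eq_bigr => b _; rewrite distrC.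
Qed.

Lemma monic_comp_Xn (R : idomainType) (f : {poly R}) k :
  (0 < k)%N -> f \is monic -> f \Po 'X^k \is monic.
Proof.
move=> k_gt0 f1; rewrite monicE lead_coef_comp ?size_polyXn //.
by rewrite (monicP f1) lead_coefXn expr1n mulr1.
Qed.

Lemma prod_rootsC_comp_Xn (f : {poly int}) k (G : algC -> algC) :
    (0 < k)%N -> f \is monic ->
  \prod_(z <- rootsC (f \Po 'X^k)) G (z ^+ k) = \prod_(a <- rootsC f) G a ^+ k.
Proof.
move=> k_gt0 f1.
pose kroots a := sval (closed_field_poly_normal ('X^k - a%:P : {poly algC})).
have krootsE a : 'X^k - a%:P = \prod_(z <- kroots a) ('X - z%:P).
  rewrite /kroots; case: closed_field_poly_normal => s /= {1}->.
  by rewrite (monicP (monicXnsubC _ _)) ?scale1r.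
have size_kroots a : size (kroots a) = k.
  by apply: succn_inj; rewrite -(size_prod_XsubC _ id) -krootsE size_XnsubC.
have rootsE : perm_eq (rootsC (f \Po 'X^k)) (flatten (map kroots (rootsC f))).
  apply: perm_rootsC; first exact: monic_comp_Xn.
  rewrite map_comp_poly /= map_polyXn pZtoC_rootsC // rmorph_prod /=.
  rewrite big_flatten big_map; apply: eq_bigr => a _.
  by rewrite comp_polyB comp_polyX comp_polyC krootsE.
rewrite (perm_big _ rootsE) big_flatten big_map; apply: eq_bigr => a _ /=.
rewrite (eq_big_seq (fun=> G a)) => [|z].
  by rewrite big_const_seq count_predT size_kroots iter_mulr_1.
by rewrite -root_prod_XsubC -krootsE rootE !hornerE subr_eq0 => /eqP->.
Qed.

Lemma resC_comp_Xn f g k : (0 < k)%N -> f \is monic -> g \is monic ->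
  resC (f \Po 'X^k) (g \Po 'X^k) = resC f g ^+ k.
Proof.
move=> k_gt0 f1 g1; rewrite !resC_horner ?monic_comp_Xn // -prodrXl.
rewrite -(prod_rootsC_comp_Xn _ k_gt0 f1); apply: eq_bigr => z _.
by rewrite map_comp_poly /= map_polyXn horner_comp hornerXn.
Qed.

Lemma map_conj_pZtoC f : map_poly Num.conj (pZtoC f) = pZtoC f.
Proof.
by rewrite -map_poly_comp; apply: eq_map_poly => x; rewrite /= rmorph_int.
Qed.

Lemma perm_rootsC_conj f :
  f \is monic -> perm_eq [seq z^* | z <- rootsC f] (rootsC f).
Proof.
move=> f1; rewrite perm_sym perm_rootsC // big_map -map_conj_pZtoC.
rewrite pZtoC_rootsC // rmorph_prod; apply: eq_bigr => z _.
by rewrite rmorphB /= map_polyX map_polyC.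
Qed.

Lemma resC_ge0 f g : f \is monic -> g \is monic ->
  {in rootsC f, forall z, z \isn't Num.real} -> 0 <= resC f g.
Proof.
move=> f1 g1 not_real; rewrite resC_horner //; set h := pZtoC g.
have hJ z : h.[z^*] = (h.[z])^* by rewrite -horner_map /= map_conj_pZtoC.
rewrite (bigID (fun z => 0 < 'Im z)) /=.
rewrite -[X in _ * X](perm_big _ (perm_rootsC_conj f1)) big_map /=.
have -> : \prod_(z <- rootsC f | ~~ (0 < 'Im z^*)) h.[z^*] =
          (\prod_(z <- rootsC f | 0 < 'Im z) h.[z])^*.
  rewrite rmorph_prod /= big_mkcond [RHS]big_mkcond; apply: eq_big_seq => z zf.
  rewrite hJ Im_conj oppr_gt0 -real_leNgt ?real0 ?Creal_Im // le_eqVlt eq_sym.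
  by case: eqP => // /Creal_ImP z_real; have := not_real z zf; rewrite z_real.
exact: mul_conjC_ge0.
Qed.

(** * Divisors of a product of coprime integers *)

Lemma divisors_gt0 d n : (0 < n)%N -> d \in divisors n -> (0 < d)%N.
Proof. by move=> n_gt0; rewrite -dvdn_divisors //; exact: dvdn_gt0. Qed.

Lemma gcdn_mul_coprime k m q d :
  coprime k m -> (q %| k)%N -> (d %| m)%N -> gcdn (q * d) k = q.
Proof.
move=> co_km qk dm; rewrite gcdnC Gauss_gcdl ?(coprime_dvdr dm) //.
exact/gcdn_idPr.
Qed.

Lemma muln_gcdn_coprime k m e :
  coprime k m -> (e %| k * m)%N -> (gcdn e k * gcdn e m)%N = e.
Proof.
move=> co_km e_km; apply/eqP; rewrite eqn_dvd; apply/andP; split.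
  rewrite Gauss_dvd ?dvdn_gcdl // (coprime_dvdl (dvdn_gcdr _ _)) //.
  exact: coprime_dvdr (dvdn_gcdr _ _) co_km.
rewrite muln_gcdl !muln_gcdr !dvdn_gcd e_km.
by rewrite (dvdn_mull k (dvdnn e)) !(dvdn_mulr _ (dvdnn e)).
Qed.

Lemma perm_divisors_coprimeM k m : coprime k m -> (0 < k)%N -> (0 < m)%N ->
  perm_eq (divisors (k * m)) [seq (q * d)%N | d <- divisors m, q <- divisors k].
Proof.
move=> co_km k_gt0 m_gt0; have km_gt0 : (0 < k * m)%N by rewrite muln_gt0 k_gt0.
have co_mk : coprime m k by rewrite coprime_sym.
apply: uniq_perm; first exact: divisors_uniq.
  apply: allpairs_uniq; rewrite ?divisors_uniq // => u v.
  move=> /allpairsP[[d q] /= [+ + ->]] /allpairsP[[d' q'] /= [+ + ->]] /=.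
  rewrite -!dvdn_divisors // => dm qk dm' qk' qd.
  congr (_, _); last first.
    by rewrite -(gcdn_mul_coprime co_km qk dm) qd (gcdn_mul_coprime co_km).
  rewrite -(gcdn_mul_coprime co_mk dm qk) mulnC qd mulnC.
  by rewrite (gcdn_mul_coprime co_mk).
move=> e; rewrite -dvdn_divisors //.
apply/idP/allpairsP => [e_km | [[d q] /= [dm qk ->]]].
  exists (gcdn e m, gcdn e k); rewrite /= -!dvdn_divisors // !dvdn_gcdr.
  by rewrite muln_gcdn_coprime.
by rewrite dvdn_mul // dvdn_divisors.
Qed.

Lemma divisors_pexpS p a :
  prime p -> divisors (p ^ a.+1) = rcons (divisors (p ^ a)) (p ^ a.+1)%N.
Proof.
move=> p_pr; have pexp_gt0 b : (0 < p ^ b)%N by rewrite expn_gt0 prime_gt0.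
apply: (irr_sorted_eq ltn_trans ltnn); first exact: sorted_divisors_ltn.
  rewrite (sorted_pairwise ltn_trans) pairwise_rcons.
  rewrite -(sorted_pairwise ltn_trans) sorted_divisors_ltn andbT.
  apply/allP => d; rewrite -dvdn_divisors //= => /(dvdn_leq (pexp_gt0 _)).
  by move=> /leq_ltn_trans; apply; rewrite ltn_exp2l ?prime_gt1.
move=> d; rewrite mem_rcons inE -!dvdn_divisors //.
apply/(dvdn_pfactor _ _ p_pr)/predU1P => [[b] | [-> | ]].
- rewrite leq_eqVlt => /predU1P[-> | b_a] ->; [by left | right].
  exact: dvdn_exp2l.
- by exists a.+1.
by case/(dvdn_pfactor _ _ p_pr) => b ba ->; exists b; rewrite // leqW.
Qed.

Lemma eq_prod_divisors (R : idomainType) (F G : nat -> R) n : (0 < n)%N ->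
    (forall d, F d != 0) ->
    (forall d, (d %| n)%N ->
       \prod_(e <- divisors d) F e = \prod_(e <- divisors d) G e) ->
  F n = G n.
Proof.
move=> + F_neq0; elim/ltn_ind: n => n IHn n_gt0 FG.
have := FG n (dvdnn n); rewrite !(big_rem n (divisors_id n_gt0)) /=.
have FG_lt : {in rem n (divisors n), F =1 G}.
  move=> d; rewrite mem_rem_uniq ?divisors_uniq // inE -dvdn_divisors //.
  case/andP=> dNn d_n; apply: IHn; last by move=> e /dvdn_trans/(_ d_n); exact: FG.
    by rewrite ltn_neqAle dNn dvdn_leq.
  exact: dvdn_gt0 d_n.
rewrite -(eq_big_seq _ FG_lt); apply: mulIf.
by rewrite prodf_seq_neq0; apply/allP => d _; exact: F_neq0.
Qed.

Lemma pfactor_ind (P : nat -> Prop) : P 1%N ->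
    (forall p a m, prime p -> (0 < a)%N -> coprime p m -> (0 < m)%N -> P m ->
       P (p ^ a * m)%N) ->
  forall n, (0 < n)%N -> P n.
Proof.
move=> P1 PM; elim/ltn_ind => n IHn n_gt0.
have [n_le1 | n_gt1] := leqP n 1.
  by have -> : n = 1%N by apply/eqP; rewrite eqn_leq n_le1.
have p_pr : prime (pdiv n) by exact: pdiv_prime.
have [m co_pm nE] := pfactor_coprime p_pr n_gt0.
have a_gt0 : (0 < logn (pdiv n) n)%N.
  by rewrite logn_gt0 mem_primes p_pr n_gt0 pdiv_dvd.
have m_gt0 : (0 < m)%N.
  by rewrite lt0n; apply: contraTneq n_gt0 => m0; rewrite nE m0.
rewrite nE mulnC; apply: PM => //; apply: IHn => //.
by rewrite [ltnRHS]nE ltn_Pmulr // -[1%N](expn0 (pdiv n)) ltn_exp2l ?prime_gt1.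
Qed.

(** * Cyclotomic polynomials and their resultants *)

Lemma sum_totient_divisors n : (0 < n)%N ->
  (\sum_(d <- divisors n) totient d)%N = n.
Proof.
move=> n_gt0; apply: succn_inj; rewrite -[RHS](size_XnsubC (1 : int)) //.
rewrite -prod_Cyclotomic // -(big_map Cyclotomic xpredT id) size_prod_monic.
  by rewrite big_map; congr _.+1; apply: eq_bigr => d _; rewrite size_Cyclotomic.
by move=> _ /mapP[d _ ->]; exact: Cyclotomic_monic.
Qed.

Lemma mem_rootsC_Cyclotomic d z : (0 < d)%N ->
  (z \in rootsC 'Phi_d) = d.-primitive_root z.
Proof.
move=> d_gt0; have [w w_prim] := C_prim_root_exists d_gt0.
rewrite mem_rootsC ?Cyclotomic_monic // (Cintr_Cyclotomic w_prim).
exact: root_cyclotomic.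
Qed.

Lemma size_rootsC_Cyclotomic d : size (rootsC 'Phi_d) = totient d.
Proof. by rewrite size_rootsC ?Cyclotomic_monic // size_Cyclotomic. Qed.

Lemma separable_Cyclotomic d : (0 < d)%N -> separable_poly (pZtoC 'Phi_d).
Proof.
move=> d_gt0; apply: (@dvdp_separable _ ('X^d - 1)).
  have -> : 'X^d - 1 = pZtoC ('X^d - 1) by rewrite rmorphB rmorph1 /= map_polyXn.
  rewrite -prod_Cyclotomic // (big_rem d) ?divisors_id //= rmorphM /=.
  exact: dvdp_mulr.
by rewrite separable_Xn_sub_1 // pnatr_eq0 -lt0n.
Qed.

Lemma uniq_rootsC_Cyclotomic d : (0 < d)%N -> uniq (rootsC 'Phi_d).
Proof.
move=> d_gt0; rewrite -separable_prod_XsubC -pZtoC_rootsC ?Cyclotomic_monic //.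
exact: separable_Cyclotomic.
Qed.

Lemma perm_rootsC_Cyclotomic_exp d k : (0 < d)%N -> (0 < k)%N -> coprime k d ->
  perm_eq [seq z ^+ k | z <- rootsC 'Phi_d] (rootsC 'Phi_d).
Proof.
move=> d_gt0 k_gt0 co_kd; have /(coprimeP _ k_gt0)[[u v] /= uv] := co_kd.
have expK z : z \in rootsC 'Phi_d -> (z ^+ k) ^+ u = z.
  rewrite mem_rootsC_Cyclotomic // => /prim_expr_order zd.
  have uE : (k * u = v * d + 1)%N.
    by rewrite mulnC -uv subnKC // ltnW // -subn_gt0 uv.
  by rewrite -exprM uE exprD mulnC exprM zd expr1n mul1r.
have exp_uniq : uniq [seq z ^+ k | z <- rootsC 'Phi_d].
  rewrite map_inj_in_uniq ?uniq_rootsC_Cyclotomic //.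
  by move=> z w /expK {2}<- /expK {2}<- ->.
have exp_sub : {subset [seq z ^+ k | z <- rootsC 'Phi_d] <= rootsC 'Phi_d}.
  move=> _ /mapP[z + ->]; rewrite !mem_rootsC_Cyclotomic // => z_prim.
  by rewrite prim_root_exp_coprime.
have [|_ eq_mem] := uniq_min_size exp_uniq exp_sub; first by rewrite size_map.
exact: uniq_perm exp_uniq (uniq_rootsC_Cyclotomic d_gt0) eq_mem.
Qed.

Lemma Cyclotomic_comp_coprime k d : coprime k d -> (0 < k)%N -> (0 < d)%N ->
  'Phi_d \Po 'X^k = \prod_(q <- divisors k) 'Phi_(q * d).
Proof.
move=> co_kd k_gt0 d_gt0.
apply: (@eq_prod_divisors _ (fun e => 'Phi_e \Po 'X^k)
          (fun e => \prod_(q <- divisors k) 'Phi_(q * e))) => // [e | e e_d].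
  by rewrite monic_neq0 // monic_comp_Xn // Cyclotomic_monic.
have e_gt0 : (0 < e)%N := dvdn_gt0 d_gt0 e_d.
rewrite -(rmorph_prod (comp_poly _)) /= prod_Cyclotomic //.
rewrite comp_polyB comp_Xn_poly -exprM comp_polyC.
rewrite -prod_Cyclotomic ?muln_gt0 ?k_gt0 //.
have co_ke := coprime_dvdr e_d co_kd.
by rewrite (perm_big _ (perm_divisors_coprimeM co_ke k_gt0 e_gt0)) big_allpairs_dep.
Qed.

Lemma Cyclotomic_comp_prime p d : prime p -> coprime p d -> (0 < d)%N ->
  'Phi_d \Po 'X^p = 'Phi_d * 'Phi_(p * d).
Proof.
move=> p_pr co_pd d_gt0; rewrite Cyclotomic_comp_coprime // ?prime_gt0 //.
have := divisors_pexpS 0 p_pr; rewrite expn1 expn0 => ->.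
by rewrite /= !big_cons big_nil mulr1 mul1n.
Qed.

Lemma Cyclotomic_pexpS p a d : prime p -> coprime p d -> (0 < d)%N ->
  'Phi_(p ^ a.+1 * d) = 'Phi_(p * d) \Po 'X^(p ^ a).
Proof.
move=> p_pr co_pd d_gt0.
have pexp_gt0 b : (0 < p ^ b)%N by rewrite expn_gt0 prime_gt0.
have comp_neq0 : 'Phi_d \Po 'X^(p ^ a) != 0.
  by rewrite monic_neq0 // monic_comp_Xn // Cyclotomic_monic.
apply: (mulfI comp_neq0); rewrite -comp_polyM -Cyclotomic_comp_prime //.
rewrite -comp_polyA comp_Xn_poly -exprM -expnSr.
rewrite !Cyclotomic_comp_coprime ?coprimeXl //.
by rewrite divisors_pexpS // -cats1 big_cat big_seq1.
Qed.

Lemma norm_prim_root (R : numDomainType) (z : R) d :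
  d.-primitive_root z -> `|z| = 1.
Proof.
move=> z_prim; apply/eqP; rewrite -(@pexpr_eq1 _ _ d) ?(prim_order_gt0 z_prim) //.
by rewrite -normrX (prim_expr_order z_prim) normr1.
Qed.

Lemma horner_deriv_comp_Xn (R : comNzRingType) (f g : {poly R}) k z :
    f * g = f \Po 'X^k -> root f z ->
  g.[z] * f^`().[z] = k%:R * z ^+ k.-1 * f^`().[z ^+ k].
Proof.
move=> /(congr1 (fun h => h^`().[z])) + /rootP fz.
rewrite derivM deriv_comp derivXn !hornerE horner_comp hornerXn fz mul0r addr0.
by rewrite hornerMn hornerXn mulr_natl mulrC => ->; rewrite mulrC.
Qed.

Lemma norm_resC_Cyclotomic_comp d k g : (0 < d)%N -> (0 < k)%N -> coprime k d ->
    g \is monic -> 'Phi_d * g = 'Phi_d \Po 'X^k ->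
  `|resC 'Phi_d g| = k%:R ^+ totient d.
Proof.
move=> d_gt0 k_gt0 co_kd g1 fg; rewrite resC_horner // normr_prod.
set f := pZtoC 'Phi_d; set s := rootsC 'Phi_d.
have f'_neq0 : \prod_(z <- s) `|f^`().[z]| != 0.
  rewrite prodf_seq_neq0; apply/allP => z zs /=; rewrite normr_eq0.
  have := separable_Cyclotomic d_gt0; rewrite unlock => /coprimep_root; apply.
  by rewrite -mem_rootsC // Cyclotomic_monic.
apply: (mulIf f'_neq0); rewrite -big_split /=.
have derivE z : z \in s ->
    `|(pZtoC g).[z]| * `|f^`().[z]| = k%:R * `|f^`().[z ^+ k]|.
  move=> zs; rewrite -normrM (@horner_deriv_comp_Xn _ _ _ k).
  - have z_prim : d.-primitive_root z by rewrite -mem_rootsC_Cyclotomic.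
    by rewrite !normrM normr_nat normrX (norm_prim_root z_prim) expr1n mulr1.
  - by rewrite -rmorphM /= fg map_comp_poly /= map_polyXn.
  by rewrite -mem_rootsC // Cyclotomic_monic.
rewrite (eq_big_seq _ derivE) big_split big_const_seq count_predT iter_mulr_1 /=.
rewrite size_rootsC_Cyclotomic; congr (_ * _).
have exp_perm := perm_rootsC_Cyclotomic_exp d_gt0 k_gt0 co_kd.
by rewrite -[RHS](perm_big _ exp_perm) big_map.
Qed.

(** * The absolute value of the product of resultants *)

Definition pexponent (p n : nat) : nat := ((n - n %/ p ^ logn p n) %/ (p - 1))%N.

Lemma pexponent_pexp p a : prime p -> pexponent p (p ^ a) = (\sum_(j < a) p ^ j)%N.
Proof.
move=> p_pr; rewrite /pexponent pfactorK // divnn expn_gt0 prime_gt0 //= !subn1.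
by rewrite predn_exp mulKn // -subn1 subn_gt0 prime_gt1.
Qed.

Lemma pexponent_coprimeM p k n : prime p -> coprime p k -> (0 < n)%N ->
  pexponent p (k * n) = (k * pexponent p n)%N.
Proof.
move=> p_pr co_pk n_gt0; rewrite /pexponent logn_Gauss //.
rewrite -muln_divA ?pfactor_dvdnn // -mulnBr muln_divA //.
rewrite -{1}[n](divnK (pfactor_dvdnn p n)) -{2}[(_ %/ _)%N]muln1 -mulnBr !subn1.
by rewrite predn_exp; apply/dvdn_mull/dvdn_mulr.
Qed.

Local Notation norm_resC_Phi := (fun d e : nat => `|resC 'Phi_d 'Phi_e|).

Definition norm_resC_pairs (n : nat) : algC :=
  prod_pairs norm_resC_Phi (divisors n).

Lemma prod_norm_resC_coprime k d e :
    coprime k d -> coprime k e -> (0 < k)%N -> (0 < d)%N -> (0 < e)%N ->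
  \prod_(q <- divisors k) \prod_(r <- divisors k)
    `|resC 'Phi_(q * d) 'Phi_(r * e)| = `|resC 'Phi_d 'Phi_e| ^+ k.
Proof.
move=> co_kd co_ke k_gt0 d_gt0 e_gt0.
have monic_Phi c q : 'Phi_(q * c) \is monic by exact: Cyclotomic_monic.
under eq_bigr do rewrite -normr_prod -(resC_prodr _ _ (monic_Phi e)).
rewrite -normr_prod -(resC_prodl _ _ (monic_Phi d)) -!Cyclotomic_comp_coprime //.
by rewrite resC_comp_Xn ?Cyclotomic_monic // normrX.
Qed.

Lemma norm_resC_pairs_coprimeM k m : coprime k m -> (0 < k)%N -> (0 < m)%N ->
  norm_resC_pairs (k * m) =
  (\prod_(d <- divisors m)
     prod_pairs norm_resC_Phi [seq (q * d)%N | q <- divisors k]) *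
  norm_resC_pairs m ^+ k.
Proof.
move=> co_km k_gt0 m_gt0; rewrite /norm_resC_pairs.
rewrite (perm_prod_pairs _ (perm_divisors_coprimeM co_km k_gt0 m_gt0)); last first.
  by move=> d e; exact: norm_resC_sym.
rewrite prod_pairs_flatten big_map prod_pairs_map -prod_pairsX; congr (_ * _).
have coprime_k d : d \in divisors m -> coprime k d.
  by rewrite -dvdn_divisors // => dm; exact: coprime_dvdr dm co_km.
apply: eq_in_prod_pairs => d e dm em; rewrite big_map.
under eq_bigr do rewrite big_map.
by apply: prod_norm_resC_coprime; rewrite ?coprime_k // (divisors_gt0 m_gt0).
Qed.

Lemma prod_pairs_norm_resC_pexp p a d : prime p -> coprime p d -> (0 < d)%N ->
  prod_pairs norm_resC_Phi [seq (q * d)%N | q <- divisors (p ^ a)] =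
  p%:R ^+ (totient d * pexponent p (p ^ a)).
Proof.
move=> p_pr co_pd d_gt0; have p_gt0 := prime_gt0 p_pr.
have monic_Phi q : 'Phi_(q * d) \is monic by exact: Cyclotomic_monic.
rewrite pexponent_pexp //; elim: a => [|a IHa].
  by rewrite big_ord0 muln0 /= big_nil mulr1.
rewrite divisors_pexpS // map_rcons prod_pairs_rcons IHa big_ord_recr mulnDr exprD.
congr (_ * _); rewrite big_map -normr_prod -(resC_prodl _ _ monic_Phi).
rewrite -Cyclotomic_comp_coprime ?coprimeXl ?expn_gt0 ?p_gt0 // Cyclotomic_pexpS //.
rewrite resC_comp_Xn ?Cyclotomic_monic ?expn_gt0 ?p_gt0 // normrX exprM.
rewrite (@norm_resC_Cyclotomic_comp _ p) ?Cyclotomic_monic //.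
by rewrite Cyclotomic_comp_prime.
Qed.

Lemma norm_resC_pairs_pexpM p a m : prime p -> coprime p m -> (0 < m)%N ->
  norm_resC_pairs (p ^ a * m) =
  p%:R ^+ pexponent p (p ^ a * m) * norm_resC_pairs m ^+ (p ^ a).
Proof.
move=> p_pr co_pm m_gt0; have pa_gt0 : (0 < p ^ a)%N by rewrite expn_gt0 prime_gt0.
rewrite norm_resC_pairs_coprimeM ?coprimeXl // mulnC pexponent_coprimeM //.
congr (_ * _); rewrite -[in RHS](sum_totient_divisors m_gt0) big_distrl -prodrXr /=.
apply: eq_big_seq => d dm; have d_gt0 := divisors_gt0 m_gt0 dm.
rewrite prod_pairs_norm_resC_pexp // (coprime_dvdr _ co_pm) //.
by rewrite dvdn_divisors.
Qed.

Lemma perm_primes_pexpM p a m : prime p -> (0 < a)%N -> coprime p m -> (0 < m)%N ->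
  perm_eq (primes (p ^ a * m)) (p :: primes m).
Proof.
move=> p_pr a_gt0 co_pm m_gt0; have p_gt0 := prime_gt0 p_pr.
apply: uniq_perm; rewrite ?primes_uniq //=.
  by rewrite primes_uniq mem_primes p_pr m_gt0 /= -prime_coprime // co_pm.
by move=> q; rewrite primesM ?expn_gt0 ?p_gt0 // primesX // primes_prime // !inE.
Qed.

Lemma norm_resC_pairsE n : (0 < n)%N ->
  norm_resC_pairs n = \prod_(p <- primes n) p%:R ^+ pexponent p n.
Proof.
elim/pfactor_ind => [|p a m p_pr a_gt0 co_pm m_gt0 IHm].
  by rewrite /norm_resC_pairs /= !big_nil mulr1.
rewrite norm_resC_pairs_pexpM // (perm_big _ (perm_primes_pexpM _ _ _ _)) //.
rewrite big_cons IHm -prodrXl; congr (_ * _); apply: eq_big_seq => q.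
rewrite mem_primes => /and3P[q_pr _ q_m]; rewrite pexponent_coprimeM //.
  by rewrite mulnC exprM.
by rewrite coprimeXr // coprime_sym (coprime_dvdr q_m).
Qed.

(** * The sign of the product of resultants *)

Lemma prim_root_not_real (R : numDomainType) (z : R) d :
  (2 < d)%N -> d.-primitive_root z -> z \isn't Num.real.
Proof.
move=> d_gt2 z_prim; apply/negP => /real_normK z2; move: d_gt2; rewrite ltnNge.
case/negP; apply: dvdn_leq => //.
by rewrite (prim_order_dvd z_prim) -z2 (norm_prim_root z_prim) expr1n.
Qed.

Lemma rootsC_Cyclotomic1 : rootsC 'Phi_1 = [:: 1].
Proof.
have : all (pred1 1) (rootsC 'Phi_1).
  apply/allP => z; rewrite mem_rootsC_Cyclotomic // => /prim_expr_order.
  by rewrite expr1 => ->; exact: eqxx.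
by move/all_pred1P; rewrite size_rootsC_Cyclotomic.
Qed.

Lemma rootsC_Cyclotomic2 : rootsC 'Phi_2 = [:: -1].
Proof.
have : all (pred1 (-1)) (rootsC 'Phi_2).
  apply/allP => z; rewrite mem_rootsC_Cyclotomic // => z_prim.
  have /eqP := prim_expr_order z_prim; rewrite sqrf_eq1 => /orP[/eqP z1 | //].
  by have := prim_order_dvd z_prim 1; rewrite expr1 z1 eqxx.
by move/all_pred1P; rewrite size_rootsC_Cyclotomic.
Qed.

Lemma resC_Cyclotomic21 : resC 'Phi_2 'Phi_1 = -2.
Proof.
by rewrite /resC rootsC_Cyclotomic1 rootsC_Cyclotomic2 !big_seq1 -opprD -natr1.
Qed.

Lemma resC_Cyclotomic_sign d e : (0 < e < d)%N ->
  resC 'Phi_d 'Phi_e = (-1) ^+ (d == 2%N) * `|resC 'Phi_d 'Phi_e|.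
Proof.
case/andP=> e_gt0 e_d; case: eqP => [d2 | /eqP dN2].
  have -> : e = 1%N by apply/eqP; rewrite eqn_leq e_gt0 -ltnS -d2 e_d.
  by rewrite d2 resC_Cyclotomic21 normrN normr_nat mulN1r.
have d_gt2 : (2 < d)%N by rewrite ltn_neqAle eq_sym dN2 (leq_ltn_trans e_gt0).
rewrite mul1r ger0_norm // resC_ge0 ?Cyclotomic_monic // => z.
rewrite mem_rootsC_Cyclotomic ?(ltn_trans _ d_gt2) //.
exact: prim_root_not_real.
Qed.

Lemma prod_sign_divisors n : (0 < n)%N ->
  \prod_(d1 <- divisors n) \prod_(d2 <- divisors n | (d1 < d2)%N)
    (-1) ^+ (d2 == 2%N) = (-1) ^+ n.-1 :> algC.
Proof.
move=> n_gt0; rewrite (bigD1_seq 1%N) ?divisor1 ?divisors_uniq //=.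
rewrite [X in _ * X]big1_seq ?mulr1 => [|d1 /andP[d1N1 d1n]]; last first.
  apply: big1 => d2; case: eqP => [-> | _ _]; last exact: expr0.
  rewrite ltnS leq_eqVlt (negPf d1N1) ltnS leqn0 => /eqP d1_0.
  by have := divisors_gt0 n_gt0 d1n; rewrite d1_0.
rewrite prodrXr -(signr_odd _ n.-1); congr (_ ^+ _).
have -> : odd n.-1 = (2 \in divisors n).
  by rewrite -dvdn_divisors // dvdn2; case: n n_gt0 => //= n; rewrite negbK.
rewrite -count_uniq_mem ?divisors_uniq // -sum1_count.
by rewrite [RHS]big_mkcond [LHS]big_mkcond; apply: eq_bigr => -[|[|[|d]]].
Qed.

Lemma prod_resC_Cyclotomic n : (0 < n)%N ->
  \prod_(d1 <- divisors n) \prod_(d2 <- divisors n | (d1 < d2)%N)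
      resC 'Phi_d2 'Phi_d1 = (-1) ^+ n.-1 * norm_resC_pairs n.
Proof.
move=> n_gt0; rewrite /norm_resC_pairs -prod_sign_divisors //.
rewrite (prod_pairs_sorted _ ltn_trans ltnn (sorted_divisors_ltn n)) -big_split /=.
apply: eq_big_seq => d1 d1n; rewrite -big_split /=; apply: eq_bigr => d2 d12.
by rewrite norm_resC_sym -resC_Cyclotomic_sign // (divisors_gt0 n_gt0 d1n).
Qed.

(** * The matrix of the cyclotomic decomposition *)

Lemma A_mat_chinese_mx n : (0 < n)%N ->
  A_mat n = chinese_mx n [seq 'Phi_d | d <- divisors n].
Proof.
move=> n_gt0; have coordsE p : chinese_coords [seq 'Phi_d | d <- divisors n] p =
    [seq (p %% 'Phi_(dk.1))`_dk.2 | dk <- row_labels n].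
  rewrite /chinese_coords /row_labels map_flatten -!map_comp; congr flatten.
  apply: eq_map => d /=; rewrite size_Cyclotomic -map_comp; apply: eq_map => k /=.
  by rewrite Pdiv.IdomainMonic.modpE ?Cyclotomic_monic.
apply/matrixP => i j; rewrite !mxE coordsE (nth_map (0%N, 0%N)) //.
rewrite -(size_map (fun dk => ('X^j %% 'Phi_(dk.1))`_dk.2)) -coordsE.
rewrite size_chinese_coords big_map.
under eq_bigr do rewrite size_Cyclotomic.
by rewrite sum_totient_divisors.
Qed.

Lemma det_A_mat n : (0 < n)%N ->
  (\det (A_mat n))%:~R =
  \prod_(d1 <- divisors n) \prod_(d2 <- divisors n | (d1 < d2)%N)
      resC 'Phi_d2 'Phi_d1.
Proof.
move=> n_gt0; rewrite A_mat_chinese_mx // det_chinese_mx; first last.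
- rewrite big_map; under eq_bigr do rewrite size_Cyclotomic.
  by rewrite sum_totient_divisors.
- by move=> _ /mapP[d _ ->]; exact: Cyclotomic_monic.
rewrite rmorph_prod_pairs prod_pairs_map.
rewrite (prod_pairs_sorted _ ltn_trans ltnn (sorted_divisors_ltn n)).
apply: eq_bigr => d1 _; apply: eq_bigr => d2 _ /=.
by rewrite det_mulmodp_resC ?Cyclotomic_monic.
Qed.

Theorem theoremA2 (n : nat) (hn : (0 < n)%N) :
  ((\det (A_mat n))%:~R : algC) =
    \prod_(d1 <- divisors n) \prod_(d2 <- divisors n | (d1 < d2)%N)
      resC 'Phi_d2 'Phi_d1
  /\
  \prod_(d1 <- divisors n) \prod_(d2 <- divisors n | (d1 < d2)%N)
      resC 'Phi_d2 'Phi_d1 =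
    (-1) ^+ n.-1 *
    \prod_(p <- primes n)
      (p%:R : algC) ^+ ((n - n %/ p ^ logn p n) %/ (p - 1))%N.
Proof.
by split; [exact: det_A_mat | rewrite prod_resC_Cyclotomic // norm_resC_pairsE].
Qed.
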